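(* Let $\mathcal{H}$ be a complex Hilbert space and let $T\in\mathcal{B}(\mathcal{H})$. Then for every $\alpha\in[0,1]$, $$\|T\|_{\alpha}^2\leq\min\left\{\left\|\alpha|T|^2+(1-\alpha)|T^*|^2\right\|,\ \left\|\alpha|T^*|^2+(1-\alpha)|T|^2\right\|\right\}.$$
   Context: $\mathcal{B}(\mathcal{H})$ denotes the $C^*$-algebra of all bounded linear operators on the complex Hilbert space $\mathcal{H}$, and $\|\cdot\|$ is the operator norm. For $T\in\mathcal{B}(\mathcal{H})$, $|T|=(T^*T)^{1/2}$ and $|T^*|=(TT^* )^{1/2}$. For $0\leq\alpha\leq1$ the $\alpha$-norm of $T$ is $$\|T\|_{\alpha}=\sup\left\{\sqrt{\alpha|\langle Tx,x\rangle|^2+(1-\alpha)\|Tx\|^2}: x\in\mathcal{H},\ \|x\|=1\right\}.$$ *)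

(* Defs.v *)
From HB Require Import structures.
From mathcomp Require Import all_boot all_order all_algebra sesquilinear.
From mathcomp Require Import complex.
From mathcomp Require Import all_classical all_reals topology normedtype.

Set Implicit Arguments.
Unset Strict Implicit.
Unset Printing Implicit Defensive.

Import Order.TTheory GRing.Theory Num.Theory.
Import numFieldNormedType.Exports.

Local Open Scope classical_set_scope.
Local Open Scope ring_scope.
Local Open Scope complex_scope.

(* The inner product is linear in its first argument and conjugate-linear in
   its second one. *)
HB.mixin Record NormedModule_isHilbert (R : realType) H
    & CompleteNormedModule R[i] H := {
  inner : {dot H for @Num.conj R[i]};
  inner_norm : forall x : H, `|x| ^+ 2 = inner x x
}.

#[short(type="hilbertType")]
HB.structure Definition Hilbert (R : realType) :=
  {H of CompleteNormedModule R[i] H & NormedModule_isHilbert R H}.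

(* Norms and moduli have type R[i] in the library although their values are
   real; [rnorm] is their value in R. *)
Definition rnorm (R : realType) (V : normedZmodType R[i]) (x : V) : R :=
  complex.Re `|x|.

Section Operators.
Variables (R : realType) (H : hilbertType R).
Implicit Types (T A S : H -> H) (x y : H) (alpha : R).

Definition bounded_operator T : Prop :=
  linear T /\ exists M : R, forall x, rnorm (T x) <= M * rnorm x.

Definition opnorm T : R := sup [set rnorm (T x) | x in [set x | rnorm x <= 1]].

(* [get] returns a default value when no witness exists; for a bounded T the
   adjoint and the positive square root of T^* T exist and are unique. *)
Definition is_adjoint T S : Prop :=
  bounded_operator S /\ forall x y, inner (T x) y = inner x (S y).

Definition adjoint T : H -> H := get (is_adjoint T).

(* The order of R[i] makes [0 <= z] say that z is real and nonnegative. *)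
Definition positive_operator S : Prop :=
  bounded_operator S /\ forall x, 0 <= inner (S x) x.

Definition is_sqrt_operator A S : Prop :=
  positive_operator S /\ S \o S = A.

Definition sqrt_operator A : H -> H := get (is_sqrt_operator A).

Definition abs_operator T : H -> H := sqrt_operator (adjoint T \o T).

(* The supremum of the empty set is 0, which is the intended value when H is
   the zero space. *)
Definition alpha_norm alpha T : R :=
  sup [set Num.sqrt (alpha * rnorm (inner (T x) x) ^+ 2
                     + (1 - alpha) * rnorm (T x) ^+ 2)
      | x in [set x | rnorm x = 1]].

End Operators.

(* Main.v *)
(* For a unit vector x put y = T x, c = <y, x>, d = y - c x and
   w = c x + (1 - alpha) d, so that
   V := alpha |<T x, x>|^2 + (1 - alpha) |T x|^2 = <T x, w> = <x, T^* w>.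
   The Cauchy-Schwarz inequality for the quadratic form
   alpha |<p, w>|^2 + (1 - alpha) |w|^2 |p|^2 gives
   V |w|^4 <= alpha |<T^* w, w>|^2 + (1 - alpha) |w|^2 |T^* w|^2, and the right
   hand side is at most |w|^2 <(alpha |T|^2 + (1 - alpha) |T^*|^2) w, w>.  This
   transfers the estimate from x to w with the roles of T and T^* exchanged;
   the other bound is immediate from |<T x, x>| <= |T^* x|.

   Adjoints come from the Riesz representation theorem.  For a contraction B
   with 1 - B = M^-2 T^* T, the iteration Y_(n+1) = (B + Y_n^2)/2 converges and
   its limit Y satisfies (1 - Y)^2 = 1 - B, whence |T| = M (1 - Y). *)

Require Import Defs.
From mathcomp Require Import all_boot all_order all_algebra sesquilinear.
From mathcomp Require Import complex ring lra.
From mathcomp Require Import all_classical all_reals topology normedtype.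
Import Order.TTheory GRing.Theory Num.Theory.
Import numFieldNormedType.Exports.
Local Open Scope classical_set_scope.
Local Open Scope ring_scope.
Local Open Scope complex_scope.

Set Implicit Arguments.
Unset Strict Implicit.
Unset Printing Implicit Defensive.

(** * Real-valued norms and moduli *)

Section RealNorm.
Context {R : realType} {V : normedZmodType R[i]}.
Implicit Types (x y : V).

Lemma rnormE x : `|x| = (rnorm x)%:C.
Proof. by rewrite /rnorm RRe_real// ger0_real. Qed.

Lemma rnorm_ge0 x : 0 <= rnorm x.
Proof. by rewrite -ler0c -rnormE. Qed.

Lemma rnorm_eq0 x : (rnorm x == 0) = (x == 0).
Proof. by rewrite -[RHS]normr_eq0 rnormE -(inj_eq (@complexI R)). Qed.

Lemma rnorm0 : rnorm (0 : V) = 0.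
Proof. by apply/eqP; rewrite rnorm_eq0. Qed.

Lemma rnormD x y : rnorm (x + y) <= rnorm x + rnorm y.
Proof. by rewrite -lecR rmorphD/= -!rnormE ler_normD. Qed.

Lemma rnormN x : rnorm (- x) = rnorm x.
Proof. by rewrite /rnorm normrN. Qed.

Lemma rnormB x y : rnorm (x - y) = rnorm (y - x).
Proof. by rewrite -opprB rnormN. Qed.

End RealNorm.

Section RealNormScale.
Context {R : realType} {V : normedModType R[i]}.
Implicit Types (x : V) (a : R[i]).

Lemma rnormZ a x : rnorm (a *: x) = rnorm a * rnorm x.
Proof. by apply: complexI; rewrite rmorphM/= -!rnormE normrZ. Qed.

Lemma rnormZr (r : R) x : 0 <= r -> rnorm (r%:C *: x) = r * rnorm x.
Proof.
move=> r0; rewrite rnormZ; congr (_ * _).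
by rewrite /rnorm ger0_norm ?ler0c.
Qed.

End RealNormScale.

Lemma archi_small {R : realType} (e : R) :
  0 < e -> exists n : nat, n.+1%:R^-1 < e.
Proof.
move=> e0; exists (Num.bound e^-1).
rewrite invf_plt ?posrE// ?ltr0Sn//.
apply: lt_le_trans (archi_boundP _) _; first by rewrite invr_ge0 ltW.
by rewrite ler_nat.
Qed.

(** * Completeness with an explicit rate *)

Section Complete.
Context {R : realType} {V : completeNormedModType R[i]}.

(** The Cauchy bound survives in the limit: [u n] is within [e n] of every later term, and later
    terms come arbitrarily close to the limit. *)
Lemma rnorm_complete (u : nat -> V) (e : nat -> R) :
  (forall r, 0 < r -> exists n, e n < r) ->
  (forall n m, (n <= m)%N -> rnorm (u m - u n) <= e n) ->
  exists l, forall n, rnorm (l - u n) <= e n.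
Proof.
move=> e0 uC.
have cu : cauchy (u @ \oo).
  apply: cauchy_exP => r r0.
  (* Radii of balls lie in [R[i]]; a positive one is real, so its real part can be compared with
     [e]. *)
  have [n nr] : exists n, e n < complex.Re r.
    by apply: e0; move: r0; rewrite ltcE => /andP[].
  exists (u n); exists n => //= m /= nm.
  rewrite -ball_normE/= rnormE.
  have -> : r = (complex.Re r)%:C by rewrite RRe_real// gtr0_real.
  by rewrite ltcR rnormB (le_lt_trans (uC _ _ nm)).
have {}cu : cvg (u @ \oo) by exact: cauchy_cvg.
exists (lim (u @ \oo)) => n.
apply/ler_addgt0Pr => r r0.
have /cvgrPdist_le/(_ r%:C) := cu.
rewrite ltcR => /(_ r0)[N _ NP].
set k := maxn n N; have := NP k (leq_maxr _ _); rewrite /= rnormE lecR => lk.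
have -> : lim (u @ \oo) - u n = (u k - u n) + (lim (u @ \oo) - u k).
  by rewrite [RHS]addrC addrA subrK.
by apply: le_trans (rnormD _ _) _; rewrite lerD ?uC ?leq_maxl.
Qed.

End Complete.

(** * Inner product algebra and the Cauchy-Schwarz inequality *)

Section InnerProduct.
Context {R : realType} {H : hilbertType R}.
Implicit Types (x y z : H) (a : R[i]).

(* [inner] with its values typed in [R[i]], which [ring] recognizes. *)
Definition ip x y : R[i] := inner x y.

Lemma ipC x y : ip x y = conjc (ip y x).
Proof. by rewrite /ip hermC expr0 mul1r. Qed.

Lemma ipDl x y z : ip (x + y) z = ip x z + ip y z.
Proof. by rewrite /ip linearDl. Qed.

Lemma ipDr x y z : ip x (y + z) = ip x y + ip x z.
Proof. by rewrite /ip linearDr. Qed.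

Lemma ipBl x y z : ip (x - y) z = ip x z - ip y z.
Proof. by rewrite /ip linearBl. Qed.

Lemma ipBr x y z : ip x (y - z) = ip x y - ip x z.
Proof. by rewrite /ip linearBr. Qed.

Lemma ipZl a x y : ip (a *: x) y = a * ip x y.
Proof. by rewrite /ip linearZl_LR. Qed.

Lemma ipZr a x y : ip x (a *: y) = conjc a * ip x y.
Proof. by rewrite /ip linearZr_LR. Qed.

Lemma ip_rnorm x : ip x x = (rnorm x ^+ 2)%:C.
Proof. by rewrite /ip -inner_norm rnormE rmorphXn. Qed.

Lemma ip_inj x y : (forall z, ip z x = ip z y) -> x = y.
Proof.
move=> xy; apply/eqP; rewrite -subr_eq0 -rnorm_eq0 -sqrf_eq0.
by rewrite -(inj_eq (@complexI R)) -ip_rnorm ipBr xy subrr.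
Qed.

Lemma ip_mulC x y : ip x y * ip y x = (rnorm (ip x y) ^+ 2)%:C.
Proof. by rewrite rmorphXn/= -rnormE normCK [ip y x]ipC. Qed.

Lemma rnorm_ipC x y : rnorm (ip x y) = rnorm (ip y x).
Proof.
apply/eqP; rewrite -(@eqrXn2 _ 2) ?rnorm_ge0//.
by rewrite -(inj_eq (@complexI R)) -!ip_mulC mulrC.
Qed.

(** The vector |y|^2 x - <x, y> y has squared norm |y|^2 (|x|^2 |y|^2 - |<x, y>|^2), and the factor
    |y|^2 cancels when y is nonzero. *)
Lemma cauchy_schwarz x y : rnorm (ip x y) <= rnorm x * rnorm y.
Proof.
have [->|y0] := eqVneq y 0.
  by rewrite /ip linear0r !rnorm0 mulr0.
have Y0 : 0 < rnorm y by rewrite lt_def rnorm_eq0 y0 rnorm_ge0.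
rewrite -(@ler_pXn2r _ 2)// ?nnegrE ?mulr_ge0 ?rnorm_ge0//.
have : 0 <= ip ((rnorm y ^+ 2)%:C *: x - ip x y *: y)
               ((rnorm y ^+ 2)%:C *: x - ip x y *: y).
  by rewrite ip_rnorm ler0c sqr_ge0.
rewrite ipBl !ipBr !ipZl !ipZr -ipC conjc_real !ip_rnorm.
set Y := (rnorm y ^+ 2)%:C; set X := (rnorm x ^+ 2)%:C.
have -> : Y * (Y * X) - Y * (ip y x * ip x y)
    - (ip x y * (Y * ip y x) - ip x y * (ip y x * Y))
  = Y * (Y * X - ip x y * ip y x) by ring.
rewrite ip_mulC /X /Y -!rmorphM -rmorphB -rmorphM/= ler0c.
rewrite pmulr_rge0 ?exprn_gt0// subr_ge0 exprMn => h.
by rewrite mulrC.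
Qed.

End InnerProduct.

Section Squares.
Context {R : realType} {H : hilbertType R}.
Implicit Types (x y : H).

Lemma ge_Re_rnorm (z : R[i]) : complex.Re z <= rnorm z.
Proof.
have h : rnorm z ^+ 2 = complex.Re z ^+ 2 + complex.Im z ^+ 2.
  by apply: complexI; rewrite rmorphXn/= -rnormE -add_Re2_Im2.
apply: le_trans (ler_norm _) _.
rewrite -(@ler_pXn2r _ 2)// ?nnegrE ?rnorm_ge0// real_normK ?num_real//.
by rewrite h lerDl sqr_ge0.
Qed.

Lemma ReC (z : R[i]) : complex.Re (conjc z) = complex.Re z.
Proof. by case: z. Qed.

Lemma rnorm2D x y :
  rnorm (x + y) ^+ 2 = rnorm x ^+ 2 + rnorm y ^+ 2 + 2 * complex.Re (ip x y).
Proof.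
have h z : rnorm z ^+ 2 = complex.Re (@ip R H z z) by rewrite ip_rnorm.
rewrite h ipDl !ipDr !raddfD/= -!h [ip y x]ipC ReC.
by ring.
Qed.

Lemma rnorm2B x y :
  rnorm (x - y) ^+ 2 = rnorm x ^+ 2 + rnorm y ^+ 2 - 2 * complex.Re (ip x y).
Proof.
by rewrite rnorm2D rnormN -scaleN1r ipZr rmorphN1 mulN1r raddfN mulrN.
Qed.

End Squares.

Lemma le_small {R : realType} (e : nat -> R) (a C : R) :
  (forall r, 0 < r -> exists n, e n < r) -> 0 <= C ->
  (forall n, a <= C * e n) -> a <= 0.
Proof.
move=> e0 C0 aC; apply/ler_addgt0Pr => r r0; rewrite add0r.
(* Dividing by [C + 1] rather than [C] covers the case [C = 0]. *)
have [n nr] := e0 (r / (C + 1)) (divr_gt0 r0 (ltr_pwDr ltr01 C0)).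
apply: le_trans (aC n) _.
apply: le_trans (ler_wpM2l C0 (ltW nr)) _.
by rewrite mulrA ler_pdivrMr ?ltr_pwDr// mulrC ler_wpM2l ?(ltW r0)// lerDl.
Qed.

(** * The Riesz representation theorem *)

Section Riesz.
Context {R : realType} {H : hilbertType R}.
Implicit Types (x y h : H).

(* The representing vector minimizes ‖z‖² - 2 Re f(z); a minimizing sequence
   is Cauchy by the parallelogram identity. *)
Lemma riesz (f : H -> R[i]) (M : R) :
  (forall a x y, f (a *: x + y) = a * f x + f y) -> 0 <= M ->
  (forall x, rnorm (f x) <= M * rnorm x) ->
  exists z, forall x, f x = ip x z.
Proof.
move=> flin M0 fM.
have fD x y : f (x + y) = f x + f y by rewrite -[x]scale1r flin !mul1r scale1r.
have f0 : f 0 = 0 by apply: (@addIr _ (f 0)); rewrite -fD !add0r.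
have fZ a x : f (a *: x) = a * f x by rewrite -[_ *: _]addr0 flin f0 addr0.
pose J z := rnorm z ^+ 2 - 2 * complex.Re (f z).
(* Since Re f(z) <= M |z|, J(z) is at least |z|^2 - 2 M |z| = (|z| - M)^2 - M^2. *)
have JM z : - M ^+ 2 <= J z.
  have := fM z; have := ge_Re_rnorm (f z); rewrite /J.
  have := sqr_ge0 (rnorm z - M).
  set a := rnorm z; set b := rnorm (f z); set c := complex.Re _ => h1 h2 h3.
  by nra.
have lbJ : has_lbound (range J) by exists (- M ^+ 2) => _ [z _ <-].
pose d (n : nat) : R := n.+1%:R^-1.
have d0 n : 0 < d n by rewrite invr_gt0.
have dmono n m : (n <= m)%N -> d m <= d n.
  by move=> nm; rewrite lef_pV2 ?posrE ?ltr0Sn// ler_nat.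
have dsmall r : 0 < r -> exists n, d n < r by exact: archi_small.
have infJ z : inf (range J) <= J z by apply: ge_inf => //; exists z.
(* The tolerance is squared because J controls squared distances. *)
have exz n : exists z, J z < inf (range J) + d n ^+ 2.
  have [||_ [z _ <-] Jz] := @inf_adherent R (range J) (d n ^+ 2).
  - by rewrite exprn_gt0.
  - by split => //; exists (J 0); exists 0.
  - by exists z.
have [z zP] := choice exz.
(* The linear part of J cancels at the midpoint. As J there is at least the infimum, |z_m - z_n|^2
   <= 2 d_m^2 + 2 d_n^2 <= 4 d_n^2 for n <= m. *)
have parallelogram u v :
    rnorm (u - v) ^+ 2 = 2 * J u + 2 * J v - 4 * J ((2^-1 : R)%:C *: (u + v)).
  rewrite /J rnormZr ?invr_ge0// exprMn rnorm2B rnorm2D fZ fD.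
  have -> : complex.Re ((2^-1 : R)%:C * (f u + f v)) =
            2^-1 * (complex.Re (f u) + complex.Re (f v)).
    by case: (f u) => a b; case: (f v) => c e /=; rewrite mul0r subr0.
  by field.
have [||l lP] := @rnorm_complete R H z (fun n => 2 * d n).
- move=> r r0; have [n nr] := dsmall (r / 2) (divr_gt0 r0 (ltr0Sn _ _)).
  by exists n; rewrite mulrC -ltr_pdivlMr.
- move=> n m nm.
  rewrite -(@ler_pXn2r _ 2)// ?nnegrE ?mulr_ge0 ?rnorm_ge0 ?(ltW (d0 _))//.
  rewrite parallelogram exprMn.
  have := infJ ((2^-1 : R)%:C *: (z m + z n)).
  have := zP n; have := zP m.
  have : d m ^+ 2 <= d n ^+ 2.
    by rewrite ler_pXn2r ?nnegrE ?(ltW (d0 _))// dmono.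
  by lra.
(* Moving z_n by t h with t = conj(g) / |h|^2 lowers J by |g|^2 / |h|^2. Near-minimality limits this
   drop to d_n^2. *)
have variation n h : rnorm (f h - ip h (z n)) <= d n * rnorm h.
  set g := f h - ip h (z n).
  have [h0|h0] := eqVneq h 0.
    by rewrite /g h0 f0 /ip linear0l subrr !rnorm0 mulr0.
  have hgt : 0 < rnorm h by rewrite lt_def rnorm_eq0 h0 rnorm_ge0.
  pose s := (rnorm h ^+ 2)^-1.
  have s0 : 0 <= s by rewrite invr_ge0 sqr_ge0.
  have sh : s * rnorm h ^+ 2 = 1 by rewrite mulVf// expf_neq0// gt_eqF.
  pose t : R[i] := s%:C * conjc g.
  have tg : t * g = (s * rnorm g ^+ 2)%:C.
    by rewrite rmorphM/= rmorphXn/= -rnormE normCK /t -mulrA [_ * g]mulrC.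
  have Jt : J (z n + t *: h) = J (z n) + rnorm t ^+ 2 * rnorm h ^+ 2
      - 2 * complex.Re (t * g).
    rewrite /J rnorm2D rnormZ fD fZ exprMn ipC ReC ipZl /g mulrBr.
    by rewrite !raddfD/= raddfN/=; ring.
  have tn : rnorm t ^+ 2 = s ^+ 2 * rnorm g ^+ 2.
    rewrite -exprMn; congr (_ ^+ 2); apply: complexI.
    by rewrite rmorphM/= -!rnormE normrM norm_conjC ger0_norm ?ler0c.
  have := infJ (z n + t *: h); rewrite Jt tg tn => h1.
  have h2 := zP n.
  have h3 : s * rnorm g ^+ 2 <= d n ^+ 2.
    have : s ^+ 2 * rnorm g ^+ 2 * rnorm h ^+ 2 = s * rnorm g ^+ 2.
      by rewrite -[RHS]mul1r -sh; ring.
    rewrite /= in h1 *; lra.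
  rewrite -(@ler_pXn2r _ 2)// ?nnegrE ?mulr_ge0 ?rnorm_ge0 ?(ltW (d0 _))//.
  rewrite exprMn -ler_pdivrMr ?exprn_gt0// mulrC.
  exact: h3.
exists l => h; apply/eqP; rewrite -subr_eq0 -rnorm_eq0 eq_le rnorm_ge0 andbT.
(* The 3 is 1 from [variation] plus 2 from the distance between z_n and its limit. *)
apply: (@le_small _ d _ (3 * rnorm h)) => //.
  by rewrite mulr_ge0 ?rnorm_ge0.
move=> n.
have -> : f h - ip h l = (f h - ip h (z n)) + ip h (z n - l).
  by rewrite ipBr addrA subrK.
apply: le_trans (rnormD _ _) _.
apply: le_trans (lerD (variation n h) (cauchy_schwarz _ _)) _.
rewrite rnormB; have := ler_wpM2l (rnorm_ge0 h) (lP n).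
by nra.
Qed.

End Riesz.

(** * Bounded operators and their adjoints *)

Section Bounded.
Context {R : realType} {H : hilbertType R}.
Implicit Types (T S : H -> H) (x y : H) (a : R[i]).

Lemma linearfD T x y : linear T -> T (x + y) = T x + T y.
Proof. by move=> Tl; rewrite -[x]scale1r Tl !scale1r. Qed.

Lemma linearf0 T : linear T -> T 0 = 0.
Proof.
by move=> Tl; apply: (@addIr _ (T 0)); rewrite -linearfD// !add0r.
Qed.

Lemma linearfZ T a x : linear T -> T (a *: x) = a *: T x.
Proof. by move=> Tl; rewrite -[_ *: x]addr0 Tl linearf0// addr0. Qed.

Lemma linearfB T x y : linear T -> T (x - y) = T x - T y.
Proof. by move=> Tl; rewrite linearfD// -scaleN1r linearfZ// scaleN1r. Qed.

Lemma bounded_gt0 T : bounded_operator T ->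
  exists2 M : R, 0 < M & forall x, rnorm (T x) <= M * rnorm x.
Proof.
move=> [_ [M TM]]; exists (`|M| + 1); first by rewrite ltr_pwDr.
move=> x; apply: le_trans (TM x) _; rewrite ler_wpM2r ?rnorm_ge0//.
by apply: le_trans (ler_norm M) _; rewrite lerDl.
Qed.

(** |S y|^2 = <T S y, y> <= M |S y| |y|; then |S y| cancels. *)
Lemma adjoint_rnorm_le T S (M : R) : 0 <= M ->
  (forall x, rnorm (T x) <= M * rnorm x) ->
  (forall x y, ip (T x) y = ip x (S y)) ->
  forall y, rnorm (S y) <= M * rnorm y.
Proof.
move=> M0 TM TS y.
have [->|Sy0] := eqVneq (S y) 0; first by rewrite rnorm0 mulr_ge0 ?rnorm_ge0.
have Sgt : 0 < rnorm (S y) by rewrite lt_def rnorm_eq0 Sy0 rnorm_ge0.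
rewrite -(ler_pM2l Sgt) -expr2.
have -> : rnorm (S y) ^+ 2 = complex.Re (ip (T (S y)) y) by rewrite TS ip_rnorm.
apply: le_trans (ge_Re_rnorm _) _; apply: le_trans (cauchy_schwarz _ _) _.
by rewrite mulrA ler_wpM2r ?rnorm_ge0// mulrC.
Qed.

(** For each y, [riesz] represents the bounded functional x -> <T x, y>; linearity of the chosen map
    follows by testing against all z. *)
Lemma adjoint_exists T : bounded_operator T -> exists S, is_adjoint T S.
Proof.
move=> Tb; have [M M0 TM] := bounded_gt0 Tb; have [Tl _] := Tb.
have ex y : exists z, forall x, ip (T x) y = ip x z.
  apply: (@riesz R H _ (M * rnorm y)).
  - by move=> a x z; rewrite Tl ipDl ipZl.
  - by rewrite mulr_ge0 ?rnorm_ge0 ?ltW.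
  - move=> x; apply: le_trans (cauchy_schwarz _ _) _.
    by rewrite mulrAC ler_wpM2r ?rnorm_ge0.
have [S SP] := choice ex; have {}SP x y := SP y x.
exists S; split => //; split; last first.
  by exists M; apply: (@adjoint_rnorm_le T); rewrite ?ltW.
move=> a x y; apply: ip_inj => z.
by rewrite -SP !ipDr !ipZr !SP.
Qed.

Lemma adjointP T : bounded_operator T -> is_adjoint T (adjoint T).
Proof. by move=> Tb; rewrite /adjoint; exact: getPex (adjoint_exists Tb). Qed.

End Bounded.

(** * Square root of 1 - B by iteration, for a symmetric contraction B *)

Section ContractionSqrt.
Context {R : realType} {H : hilbertType R}.
Variable B : H -> H.
Hypothesis B_linear : linear B.
Hypothesis B_contr : forall x, rnorm (B x) <= rnorm x.
Hypothesis B_sym : forall x y, ip (B x) y = ip x (B y).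
Implicit Types (x y : H) (n m : nat).

Fixpoint sqrt_iter n : H -> H :=
  if n is k.+1 then
    fun x => (2^-1 : R)%:C *: (B x + sqrt_iter k (sqrt_iter k x))
  else fun=> 0.

(* The same recursion at the scalar [1] dominates the operator one. *)
Fixpoint sqrt_bound n : R :=
  if n is k.+1 then 2^-1 * (1 + sqrt_bound k ^+ 2) else 0.

Local Notation Y := sqrt_iter.
Local Notation b := sqrt_bound.

Lemma sqrt_bound_ge0 n : 0 <= b n.
Proof.
by case: n => //= n; rewrite mulr_ge0 ?invr_ge0// addr_ge0 ?sqr_ge0.
Qed.

Lemma sqrt_bound_le1 n : b n <= 1.
Proof.
elim: n => //= n ih; have := sqrt_bound_ge0 n; nra.
Qed.

Lemma sqrt_bound_mono n m : (n <= m)%N -> b n <= b m.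
Proof.
(* The increment is (1 - b_k)^2 / 2. *)
have step k : b k <= b k.+1 by have := sqr_ge0 (1 - b k); rewrite /=; nra.
elim: m => [|m ih]; first by rewrite leqn0 => /eqP ->.
rewrite leq_eqVlt ltnS => /predU1P[->//|/ih h].
exact: le_trans h (step m).
Qed.

Lemma sqrt_iter_linear n : linear (Y n).
Proof.
elim: n => [|n ih] a x y /=; first by rewrite scaler0 addr0.
rewrite B_linear !ih scalerA mulrC -scalerA -scalerDr.
by rewrite scalerDr addrACA -!scalerDr.
Qed.

Lemma sqrt_iter_sym n x y : ip (Y n x) y = ip x (Y n y).
Proof.
elim: n x y => [|n ih] x y /=; first by rewrite /ip linear0l linear0r.
by rewrite ipZl ipZr conjc_real ipDl ipDr B_sym !ih.
Qed.

Lemma sqrt_iter_le n x : rnorm (Y n x) <= b n * rnorm x.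
Proof.
elim: n x => [|n ih] x /=; first by rewrite rnorm0 mul0r.
rewrite rnormZr ?invr_ge0// -mulrA ler_wpM2l ?invr_ge0//.
apply: le_trans (rnormD _ _) _; rewrite mulrDl mul1r lerD// expr2 -mulrA.
by apply: le_trans (ih _) _; rewrite ler_wpM2l ?sqrt_bound_ge0.
Qed.

(** A difference of squares is split as Y'^2 - Y^2 = Y' (Y' - Y) + (Y' - Y) Y, which requires no
    commutation. The scalars [b] satisfy the same identity, so the bounds match term by term. *)
Lemma sqrt_iter_step n x :
  rnorm (Y n.+1 x - Y n x) <= (b n.+1 - b n) * rnorm x.
Proof.
elim: n x => [|n ih] x.
  have -> : b 1 - b 0 = 2^-1 by rewrite /= expr0n/= addr0 mulr1 subr0.
  by rewrite /= subr0 addr0 rnormZr ?invr_ge0// ler_wpM2l ?B_contr ?invr_ge0.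
have -> : Y n.+2 x - Y n.+1 x = (2^-1 : R)%:C *:
    (Y n.+1 (Y n.+1 x - Y n x) + (Y n.+1 (Y n x) - Y n (Y n x))).
  rewrite (linearfB _ _ (@sqrt_iter_linear _)).
  rewrite subrKA -[LHS]/((2^-1 : R)%:C *: (B x + Y n.+1 (Y n.+1 x))
    - (2^-1 : R)%:C *: (B x + Y n (Y n x))).
  by rewrite -scalerBr opprD addrACA subrr add0r.
have -> : b n.+2 - b n.+1 =
    2^-1 * (b n.+1 * (b n.+1 - b n) + (b n.+1 - b n) * b n).
  rewrite -[LHS]/(2^-1 * (1 + b n.+1 ^+ 2) - 2^-1 * (1 + b n ^+ 2)).
  by ring.
rewrite rnormZr ?invr_ge0// -mulrA ler_wpM2l ?invr_ge0//.
rewrite mulrDl -[b n.+1 * _ * _]mulrA -[_ * b n * _]mulrA.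
apply: le_trans (rnormD _ _) _; apply: lerD.
  by apply: le_trans (sqrt_iter_le _ _) _; rewrite ler_wpM2l ?sqrt_bound_ge0.
apply: le_trans (ih _) _; rewrite ler_wpM2l ?subr_ge0 ?sqrt_bound_mono//.
exact: sqrt_iter_le.
Qed.

Lemma sqrt_iter_dist n m x : (n <= m)%N ->
  rnorm (Y m x - Y n x) <= (b m - b n) * rnorm x.
Proof.
elim: m => [|m ih].
  by rewrite leqn0 => /eqP ->; rewrite !subrr rnorm0 mul0r.
rewrite leq_eqVlt ltnS => /predU1P[->|/ih h].
  by rewrite !subrr rnorm0 mul0r.
rewrite -[Y m.+1 x](subrK (Y m x)) -addrA.
apply: le_trans (rnormD _ _) _.
have := sqrt_iter_step m x; lra.
Qed.

(* With Y = (B + Y²)/2 the limit of the iteration, (1 - Y)² = 1 - B. *)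
Lemma contraction_sqrt : exists P : H -> H,
  [/\ linear P, forall x, rnorm (P x) <= rnorm x,
      forall x y, ip (P x) y = ip x (P y)
    & forall x, (x - P x) - P (x - P x) = x - B x].
Proof.
pose L := sup (range b).
have supb : has_sup (range b).
  split; first by exists (b 0%N); exists 0%N.
  by exists 1 => _ [n _ <-]; exact: sqrt_bound_le1.
have bL n : b n <= L by apply: ub_le_sup; [exact: supb.2 | exists n].
have L1 : L <= 1.
  by apply: ge_sup; [exact: supb.1 | move=> _ [n _ <-]; exact: sqrt_bound_le1].
(* The remaining increase of the scalar sequence bounds the distance from Y_n to its limit. *)
pose e n := L - b n.
have e0 n : 0 <= e n by rewrite subr_ge0.
have esmall r : 0 < r -> exists n, e n < r.
  move=> r0; have [_ [n _ <-] h] := sup_adherent r0 supb.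
  by exists n; rewrite /e ltrBlDr addrC -ltrBlDr.
have ex x : exists l, forall n, rnorm (l - Y n x) <= e n * rnorm x.
  apply: rnorm_complete => [r r0|n m nm].
    have x1 : 0 < rnorm x + 1 by rewrite ltr_pwDr ?rnorm_ge0.
    have [n nr] := esmall (r / (rnorm x + 1)) (divr_gt0 r0 x1).
    exists n; apply: le_lt_trans (_ : e n * (rnorm x + 1) < r).
      by rewrite ler_wpM2l// lerDl.
    by rewrite -ltr_pdivlMr.
  apply: le_trans (sqrt_iter_dist x nm) _.
  by rewrite ler_wpM2r ?rnorm_ge0// lerB.
have [P PY] := choice ex.
have eq0 (x : H) C : 0 <= C -> (forall n, rnorm x <= C * e n) -> x = 0.
  move=> C0 xC; apply/eqP; rewrite -rnorm_eq0 eq_le rnorm_ge0 andbT.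
  exact: le_small esmall C0 xC.
have Plin : linear P.
  move=> a x y; apply/eqP; rewrite -subr_eq0; apply/eqP.
  apply: (@eq0 _ (rnorm (a *: x + y) + rnorm a * rnorm x + rnorm y)).
    by rewrite !addr_ge0 ?mulr_ge0 ?rnorm_ge0.
  move=> n.
  (* Linearity of Y_n leaves only three approximation errors, each proportional to [e n]. *)
  have -> : P (a *: x + y) - (a *: P x + P y) =
     (P (a *: x + y) - Y n (a *: x + y))
     - a *: (P x - Y n x) - (P y - Y n y).
    rewrite sqrt_iter_linear scalerBr !opprD !opprK !addrA.
    rewrite [RHS](ACl (1*4*6*((2*5)*(3*7)))%AC)/=.
    by rewrite !addNr !addr0.
  apply: le_trans (rnormD _ _) _; rewrite mulrDl rnormN.
  apply: lerD; last first.
    by rewrite mulrC.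
  apply: le_trans (rnormD _ _) _; rewrite mulrDl rnormN; apply: lerD.
    by rewrite mulrC.
  by rewrite rnormZ -mulrA ler_wpM2l ?rnorm_ge0// mulrC.
have Ple x : rnorm (P x) <= rnorm x.
  (* Y_0 and b_0 vanish, so the error bound at 0 reads |P x| <= L |x|. *)
  rewrite -[P x](subrK (Y 0%N x)); apply: le_trans (rnormD _ _) _.
  rewrite /= rnorm0 addr0; apply: le_trans (PY x 0%N) _.
  by rewrite /e subr0 ler_piMl ?rnorm_ge0.
exists P; split => //.
- move=> x y; apply/eqP; rewrite -subr_eq0 -rnorm_eq0 eq_le rnorm_ge0 andbT.
  apply: (@le_small _ e _ (2 * (rnorm x * rnorm y))) => //.
    by rewrite !mulr_ge0 ?rnorm_ge0.
  move=> n.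
  have -> : ip (P x) y - ip x (P y) = ip (P x - Y n x) y - ip x (P y - Y n y).
    by rewrite ipBl ipBr sqrt_iter_sym; ring.
  apply: le_trans (rnormD _ _) _; rewrite rnormN.
  apply: le_trans (lerD (cauchy_schwarz _ _) (cauchy_schwarz _ _)) _.
  have := ler_wpM2r (rnorm_ge0 y) (PY x n).
  have := ler_wpM2l (rnorm_ge0 x) (PY y n).
  by lra.
- move=> x.
  have fixP : P x = (2^-1 : R)%:C *: (B x + P (P x)).
    apply/eqP; rewrite -subr_eq0; apply/eqP.
    (* Subtracting the recursion for Y_(n+1) leaves three errors, each at most [e n] times |x|. *)
    apply: (@eq0 _ (3 * rnorm x)); first by rewrite mulr_ge0 ?rnorm_ge0.
    move=> n.
    have -> : P x - (2^-1 : R)%:C *: (B x + P (P x)) = (P x - Y n.+1 x)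
       - (2^-1 : R)%:C *: (Y n (P x - Y n x) + (P (P x) - Y n (P x))).
      rewrite (linearfB _ _ (@sqrt_iter_linear _)).
      rewrite [X in _ = _ - _ *: X]addrC subrKA.
      rewrite -[Y n.+1 x]/((2^-1 : R)%:C *: (B x + Y n (Y n x))).
      rewrite -[RHS]addrA -opprD -scalerDr [P (P x) - _]addrC.
      by rewrite [in RHS]addrA addrK.
    apply: le_trans (rnormD _ _) _; rewrite rnormN rnormZr ?invr_ge0//.
    have h1 := PY x n.+1.
    have h2 : rnorm (Y n (P x - Y n x)) <= e n * rnorm x.
      apply: le_trans (sqrt_iter_le _ _) _; apply: le_trans (PY x n).
      by rewrite ler_piMl ?rnorm_ge0 ?sqrt_bound_le1.
    have h3 : rnorm (P (P x) - Y n (P x)) <= e n * rnorm x.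
      by apply: le_trans (PY _ n) _; rewrite ler_wpM2l.
    have h4 := rnormD (Y n (P x - Y n x)) (P (P x) - Y n (P x)).
    have h5 : e n.+1 * rnorm x <= e n * rnorm x.
      by rewrite ler_wpM2r ?rnorm_ge0// lerB ?sqrt_bound_mono.
    have := rnorm_ge0 x; have := e0 n.
    have := mulr_ge0 (e0 n) (rnorm_ge0 x).
    lra.
  have fix2 : P x + P x = B x + P (P x).
    rewrite {1 2}fixP -scalerDl -rmorphD/=.
    have -> : 2^-1 + 2^-1 = 1 :> R by field.
    by rewrite scale1r.
  rewrite (linearfB _ _ Plin) opprB [P (P x) - _]addrC addrA.
  by rewrite -[x - P x - P x]addrA -opprD fix2 opprD addrA subrK.
Qed.

End ContractionSqrt.

(** * Existence of the absolute value of an operator *)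

Section SqrtOperator.
Context {R : realType} {H : hilbertType R}.
Implicit Types (T S : H -> H).

Lemma sqrt_operator_exists T S : bounded_operator T -> is_adjoint T S ->
  exists P, is_sqrt_operator (S \o T) P.
Proof.
move=> Tb [Sb TS]; have [M M0 TM] := bounded_gt0 Tb.
have [Tl _] := Tb; have [Sl _] := Sb.
have {}TS x y : ip (T x) y = ip x (S y) by exact: TS.
have SM := adjoint_rnorm_le (ltW M0) TM TS.
pose k : R := M ^- 2.
have k0 : 0 <= k by rewrite invr_ge0 sqr_ge0.
have kM : k * M ^+ 2 = 1 by rewrite mulVf// expf_neq0// gt_eqF.
pose B x := x - k%:C *: S (T x).
have [|||P [Pl Ple Psym PB]] := @contraction_sqrt R H B.
- move=> a x y; rewrite /B Tl Sl scalerDr opprD addrACA scalerBr.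
  by rewrite !scalerA [a * _]mulrC.
(* |B x|^2 = |x|^2 - 2k |T x|^2 + k^2 |S T x|^2, and k M^2 = 1 bounds the last term by k |T x|^2. *)
- move=> x; rewrite -(@ler_pXn2r _ 2)// ?nnegrE ?rnorm_ge0// rnorm2B.
  rewrite rnormZr// ipZr conjc_real -TS ip_rnorm -rmorphM/= exprMn.
  have h : rnorm (S (T x)) ^+ 2 <= M ^+ 2 * rnorm (T x) ^+ 2.
    by rewrite -exprMn ler_pXn2r ?nnegrE ?mulr_ge0 ?rnorm_ge0 ?(ltW M0).
  have {}h : k ^+ 2 * rnorm (S (T x)) ^+ 2 <= k * rnorm (T x) ^+ 2.
    rewrite expr2 -mulrA ler_wpM2l// -[leRHS]mul1r -kM -mulrA.
    by rewrite ler_wpM2l.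
  have := mulr_ge0 k0 (sqr_ge0 (rnorm (T x))); lra.
- move=> x y; rewrite ipBl ipBr ipZl ipZr conjc_real; congr (_ - _ * _).
  by rewrite -TS ipC -TS -ipC.
exists (fun x => M%:C *: (x - P x)); split; first split; first split.
- move=> a x y; rewrite Pl opprD addrACA -scalerBr scalerDr.
  by rewrite !scalerA [_ * a]mulrC.
- exists (M * 2) => x; rewrite rnormZr ?(ltW M0)// -mulrA ler_wpM2l ?(ltW M0)//.
  apply: le_trans (rnormD _ _) _; rewrite rnormN.
  by have := Ple x; lra.
- move=> x; rewrite -[inner _ _]/(ip _ _) ipZl mulr_ge0 ?ler0c ?(ltW M0)//.
  rewrite ipBl ip_rnorm.
  (* Symmetry of P makes <P x, x> real; Cauchy-Schwarz then bounds it by |x|^2, so 1 - P is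
     positive. *)
  have -> : ip (P x) x = (complex.Re (ip (P x) x))%:C.
    have : conjc (ip (P x) x) = ip (P x) x by rewrite -ipC Psym.
    by case: (ip (P x) x) => a b [] /eqP; rewrite -subr_eq0 -opprD oppr_eq0
      -mulr2n mulrn_eq0/= => /eqP ->.
  rewrite -rmorphB ler0c subr_ge0; apply: le_trans (ge_Re_rnorm _) _.
  apply: le_trans (cauchy_schwarz _ _) _; rewrite expr2 ler_wpM2r ?rnorm_ge0//.
- apply/funext => x /=.
  rewrite (linearfZ _ _ Pl) -scalerBr PB /B opprB addrC subrK !scalerA.
  by rewrite -!rmorphM/= -expr2 mulrC kM scale1r.
Qed.

Lemma abs_operatorP T : bounded_operator T ->
  is_sqrt_operator (adjoint T \o T) (abs_operator T).
Proof.
move=> Tb; rewrite /abs_operator /sqrt_operator.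
exact: getPex (sqrt_operator_exists Tb (adjointP Tb)).
Qed.

(** This removes absolute values from quadratic forms: <|T|^2 x, x> = <x, |T|^2 x> = |T x|^2. *)
Lemma ip_abs_operator2 T x : bounded_operator T ->
  ip (abs_operator T (abs_operator T x)) x = (rnorm (T x) ^+ 2)%:C.
Proof.
move=> Tb; have [_ /(congr1 (@^~ x))/= ->] := abs_operatorP Tb.
have [_ TS] := adjointP Tb.
by rewrite ipC -[ip x _]TS -ipC -ip_rnorm.
Qed.

End SqrtOperator.

(** * Operator norm and alpha-norm estimates *)

Section OperatorNorm.
Context {R : realType} {H : hilbertType R}.
Implicit Types (A T : H -> H) (x : H).

Lemma bounded_comp A T :
  bounded_operator A -> bounded_operator T -> bounded_operator (A \o T).
Proof.
move=> Ab [Tl [K TK]]; have [M M0 AM] := bounded_gt0 Ab.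
split=> [a x y|]; first by case: Ab => Al _; rewrite /= Tl Al.
exists (M * K) => x /=; apply: le_trans (AM _) _.
by rewrite -mulrA ler_wpM2l ?(ltW M0).
Qed.

Lemma bounded_lincomb (a b : R[i]) A T : bounded_operator A ->
  bounded_operator T -> bounded_operator (a *: A + b *: T).
Proof.
move=> [Al [M AM]] [Tl [K TK]]; split=> [c x y|].
  rewrite -[LHS]/(a *: A (c *: x + y) + b *: T (c *: x + y)) Al Tl.
  rewrite -[RHS]/(c *: (a *: A x + b *: T x) + (a *: A y + b *: T y)).
  rewrite !scalerDr !scalerA [a * c]mulrC [b * c]mulrC.
  by rewrite addrACA.
exists (rnorm a * M + rnorm b * K) => x.
apply: le_trans (rnormD _ _) _; rewrite mulrDl -!mulrA.
by apply: lerD; rewrite rnormZ ler_wpM2l ?rnorm_ge0.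
Qed.

Lemma opnorm_has_sup A : bounded_operator A ->
  has_sup [set rnorm (A x) | x in [set x | rnorm x <= 1]].
Proof.
move=> Ab; have [M M0 AM] := bounded_gt0 Ab; split.
  by exists (rnorm (A 0)), 0; rewrite //= rnorm0.
exists M => _ [x /= x1 <-]; apply: le_trans (AM x) _.
by rewrite ler_piMr ?(ltW M0).
Qed.

Lemma opnorm_ge0 A : bounded_operator A -> 0 <= opnorm A.
Proof.
move=> Ab; apply: le_trans (rnorm_ge0 (A 0)) _.
apply: ub_le_sup; first exact: (opnorm_has_sup Ab).2.
by exists 0; rewrite //= rnorm0.
Qed.

Lemma rnorm_le_opnorm A x : bounded_operator A ->
  rnorm (A x) <= opnorm A * rnorm x.
Proof.
move=> Ab; have [Al _] := Ab.
have [->|x0] := eqVneq x 0; first by rewrite (linearf0 Al) !rnorm0 mulr0.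
have xgt : 0 < rnorm x by rewrite lt_def rnorm_eq0 x0 rnorm_ge0.
rewrite -ler_pdivrMr// mulrC -rnormZr ?invr_ge0 ?rnorm_ge0//.
rewrite -(linearfZ _ _ Al).
apply: ub_le_sup; first exact: (opnorm_has_sup Ab).2.
exists ((rnorm x)^-1%:C *: x) => //=.
by rewrite rnormZr ?invr_ge0 ?rnorm_ge0// mulVf// gt_eqF.
Qed.

Lemma Re_ip_le_opnorm A x : bounded_operator A ->
  complex.Re (ip (A x) x) <= opnorm A * rnorm x ^+ 2.
Proof.
move=> Ab; apply: le_trans (ge_Re_rnorm _) _.
apply: le_trans (cauchy_schwarz _ _) _.
by rewrite expr2 mulrA ler_wpM2r ?rnorm_ge0// rnorm_le_opnorm.
Qed.

Lemma alpha_norm_sqr_le (alpha N : R) T : 0 <= N ->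
  (forall x, rnorm x = 1 ->
    alpha * rnorm (inner (T x) x) ^+ 2 + (1 - alpha) * rnorm (T x) ^+ 2 <= N) ->
  alpha_norm alpha T ^+ 2 <= N.
Proof.
move=> N0 TN; rewrite /alpha_norm; set E := image _ _.
have ubE : ubound E (Num.sqrt N).
  by move=> _ [x /= x1 <-]; rewrite ler_sqrt// TN.
(* Without unit vectors the supremum takes its default value 0, and the claim is [0 <= N]. *)
have [->|/set0P[r Er]] := eqVneq E set0; first by rewrite sup0 expr0n.
have supE0 : 0 <= sup E.
  apply: le_trans (_ : r <= _); first by case: Er => x _ <-; exact: sqrtr_ge0.
  by apply: ub_le_sup Er; exists (Num.sqrt N).
rewrite -[leRHS](sqr_sqrtr N0) ler_pXn2r ?nnegrE ?sqrtr_ge0//.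
by apply: ge_sup ubE; exists r.
Qed.

End OperatorNorm.

(** * The two pointwise bounds on unit vectors *)

Section Inequality.
Context {R : realType} {H : hilbertType R}.
Variables (T S : H -> H) (alpha N : R).
Hypotheses (alpha_ge0 : 0 <= alpha) (alpha_le1 : alpha <= 1).
Hypothesis TS : forall x y, ip (T x) y = ip x (S y).

(** Take w = x and use |<T x, x>| = |<x, S x>| <= |S x|. *)
Lemma alpha_form_le_adjoint x : rnorm x = 1 ->
  (forall w, alpha * rnorm (S w) ^+ 2 + (1 - alpha) * rnorm (T w) ^+ 2
     <= N * rnorm w ^+ 2) ->
  alpha * rnorm (ip (T x) x) ^+ 2 + (1 - alpha) * rnorm (T x) ^+ 2 <= N.
Proof.
move=> x1 /(_ x); rewrite x1 expr1n mulr1; apply: le_trans.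
rewrite lerD2r ler_wpM2l// ler_pXn2r ?nnegrE ?rnorm_ge0// TS.
by apply: le_trans (cauchy_schwarz _ _) _; rewrite x1 mul1r.
Qed.

(** The computation takes place in [R[i]], with conjugates named separately ([c'], [r']) so that
    [ring] treats them as independent scalars. *)
Lemma alpha_form_le x : rnorm x = 1 -> 0 <= N ->
  (forall w, alpha * rnorm (T w) ^+ 2 + (1 - alpha) * rnorm (S w) ^+ 2
     <= N * rnorm w ^+ 2) ->
  alpha * rnorm (ip (T x) x) ^+ 2 + (1 - alpha) * rnorm (T x) ^+ 2 <= N.
Proof.
move=> x1 N0 TSN.
pose beta := 1 - alpha; have beta0 : 0 <= beta by rewrite subr_ge0.
rewrite -/beta.
pose a := alpha%:C; pose b := beta%:C.
have ab : a = 1 - b by rewrite /a /b rmorphB/= rmorph1 subKr.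
pose c := ip (T x) x; pose c' := ip x (T x).
(* Equivalently w = alpha <T x, x> x + (1 - alpha) T x, with d orthogonal to x. *)
pose d := T x - c *: x; pose w := c *: x + b *: d; pose v := S w.
have cc : conjc c = c' by rewrite /c' [RHS]ipC.
have cc' : conjc c' = c by rewrite /c [RHS]ipC.
have xx : ip x x = 1 by rewrite ip_rnorm x1 expr1n.
have dx : ip d x = 0 by rewrite ipBl ipZl xx mulr1 subrr.
have xd : ip x d = 0 by rewrite ipC dx conjc0.
pose D := ip d d.
have Tx : T x = c *: x + d by rewrite /d addrC subrK.
have xw : ip x w = c' by rewrite ipDr !ipZr xx xd cc mulr0 addr0 mulr1.
have wx : ip w x = c by rewrite ipC xw cc'.
have dw : ip d w = b * D by rewrite ipDr !ipZr dx mulr0 add0r conjc_real.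
have wd : ip w d = b * D.
  by rewrite ipC dw /b /D ip_rnorm -rmorphM conjc_real.
pose V := c * c' + b * D.
pose W := c * c' + b ^+ 2 * D.
have ww : ip w w = W by rewrite {1}/w ipDl !ipZl xw dw /W mulrA -expr2.
have xv : ip x v = V by rewrite -TS Tx ipDl ipZl xw dw.
pose Vr := rnorm c ^+ 2 + beta * rnorm d ^+ 2.
have VVr : V = Vr%:C.
  by rewrite /V /D ip_rnorm /c /c' ip_mulC -rmorphM -rmorphD.
have cV : conjc V = V by rewrite VVr conjc_real.
have vx : ip v x = V by rewrite ipC xv cV.
pose r := ip v d; pose r' := ip d v.
have vw : ip v w = c' * V + b * r by rewrite ipDr !ipZr vx cc conjc_real.
have wv : ip w v = c * V + b * r' by rewrite ipDl !ipZl xv.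
pose z := V *: x - (a * c') *: d; pose u := v - z.
have cac : conjc (a * c') = a * c.
  have ca : conjc a = a := conjc_real alpha.
  by rewrite -cc' -{2}ca; exact: rmorphM.
have uw : ip u w = c' * V + b * r - (V * c' - a * c' * (b * D)).
  by rewrite ipBl ipBl !ipZl vw xw dw.
have wu : ip w u = c * V + b * r' - (V * c - a * c * (b * D)).
  by rewrite ipBr ipBr !ipZr wv wx wd cV cac.
have uu : ip u u = ip v v - (V * V - a * c * r) - (V * V - a * c' * r')
    + (V * V + a ^+ 2 * (c * c') * D).
  rewrite ipBl !ipBr !ipBl !ipZl !ipZr cV cac vx xv xx xd dx -/r -/r' -/D.
  by ring.
(* [form p] is the quadratic form of the operator alpha w w^* + beta |w|^2;
   that operator maps z to W^2 x, so that expanding form (v - z) >= 0 is the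
   Cauchy-Schwarz inequality for v and z. *)
pose form p := a * (ip p w * ip w p) + b * W * ip p p.
have form_v : form v = form u + W ^+ 2 * V.
  by rewrite /form uu uw wu vw wv ab /W /V; ring.
have formE p : form p = (alpha * rnorm (ip p w) ^+ 2
    + beta * (rnorm w ^+ 2 * rnorm p ^+ 2))%:C.
  by rewrite /form ip_mulC -ww !ip_rnorm -mulrA /a /b -!rmorphM -rmorphD.
pose Wr := rnorm w ^+ 2.
have WWr : W = Wr%:C by rewrite -ww ip_rnorm.
have low : Wr ^+ 2 * Vr <= alpha * rnorm (ip v w) ^+ 2
    + beta * (rnorm w ^+ 2 * rnorm v ^+ 2).
  rewrite -lecR -formE form_v WWr VVr -rmorphXn -rmorphM/= lerDr formE ler0c.
  exact: addr_ge0 (mulr_ge0 alpha_ge0 (sqr_ge0 _))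
    (mulr_ge0 beta0 (mulr_ge0 (sqr_ge0 _) (sqr_ge0 _))).
have vwT : rnorm (ip v w) ^+ 2 <= Wr * rnorm (T w) ^+ 2.
  rewrite rnorm_ipC -TS rnorm_ipC /Wr -exprMn.
  by rewrite ler_pXn2r ?nnegrE ?mulr_ge0 ?rnorm_ge0// cauchy_schwarz.
(* By Pythagoras |T x|^2 = |c|^2 + |d|^2, and alpha + beta = 1. *)
have goalE : Vr = alpha * rnorm (ip (T x) x) ^+ 2 + beta * rnorm (T x) ^+ 2.
  apply: complexI; rewrite -VVr.
  transitivity (a * (c * c') + b * ip (T x) (T x)).
    have dy : ip d (T x) = D by rewrite Tx ipDr ipZr dx mulr0 add0r.
    have yy : ip (T x) (T x) = c * c' + D.
      by rewrite [X in ip X _]Tx ipDl ipZl dy.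
    by rewrite yy ab /V; ring.
  by rewrite ip_mulC ip_rnorm /a /b -!rmorphM -rmorphD.
rewrite -goalE.
have Wr0 : 0 <= Wr by rewrite sqr_ge0.
(* If w = 0 then V = <x, S w> = 0. Otherwise W^2 V <= W (alpha |T w|^2 + beta |S w|^2) <= N W^2, and
   W^2 cancels. *)
have [W0|Wn0] := eqVneq Wr 0.
  have w0 : w = 0 by apply/eqP; rewrite -rnorm_eq0 -sqrf_eq0 -/Wr W0.
  suff -> : Vr = 0 by [].
  by apply: complexI; rewrite -VVr -xv /v -TS w0 /ip linear0r.
have Wgt : 0 < Wr ^+ 2 by rewrite exprn_gt0// lt_def Wn0.
rewrite -(ler_pM2l Wgt); apply: le_trans low _.
have := ler_wpM2l alpha_ge0 vwT.
have := ler_wpM2l Wr0 (TSN w); rewrite -/beta -/v -/Wr.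
by nra.
Qed.

End Inequality.

Theorem theorem2p4 (R : realType) (H : hilbertType R) (T : H -> H)
    (T_bounded : bounded_operator T) (alpha : R)
    (alpha_ge0 : 0 <= alpha) (alpha_le1 : alpha <= 1) :
  alpha_norm alpha T ^+ 2 <=
  Num.min
    (opnorm (alpha%:C *: (abs_operator T \o abs_operator T)
             + (1 - alpha)%:C *:
               (abs_operator (adjoint T) \o abs_operator (adjoint T))))
    (opnorm (alpha%:C *:
               (abs_operator (adjoint T) \o abs_operator (adjoint T))
             + (1 - alpha)%:C *: (abs_operator T \o abs_operator T))).
Proof.
have [adj_bounded TS] := adjointP T_bounded.
have abs_bounded (A : H -> H) :
    bounded_operator A -> bounded_operator (abs_operator A).
  by move=> /abs_operatorP[[]].
have comb_bounded (p q : R) (A B : H -> H) :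
    bounded_operator A -> bounded_operator B ->
    bounded_operator (p%:C *: (abs_operator A \o abs_operator A)
                      + q%:C *: (abs_operator B \o abs_operator B)).
  by move=> Ab Bb; apply: bounded_lincomb; apply: bounded_comp;
    apply: abs_bounded.
have comb_form (p q : R) (A B : H -> H) w :
    bounded_operator A -> bounded_operator B ->
    p * rnorm (A w) ^+ 2 + q * rnorm (B w) ^+ 2 <=
    opnorm (p%:C *: (abs_operator A \o abs_operator A)
            + q%:C *: (abs_operator B \o abs_operator B)) * rnorm w ^+ 2.
  move=> Ab Bb.
  apply: le_trans (Re_ip_le_opnorm w (comb_bounded p q A B Ab Bb)).
  by rewrite ipDl !ipZl /= !ip_abs_operator2// -!rmorphM -rmorphD.
(* The first norm weights |T w|^2 by alpha and needs the transfer to w; the second weights |S w|^2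
   by alpha and is direct. *)
rewrite le_min; apply/andP; split; apply: alpha_norm_sqr_le.
- exact/opnorm_ge0/comb_bounded.
- move=> x x1; apply: (alpha_form_le alpha_ge0 alpha_le1 TS x1).
    exact/opnorm_ge0/comb_bounded.
  by move=> w; apply: comb_form.
- exact/opnorm_ge0/comb_bounded.
- move=> x x1; apply: (alpha_form_le_adjoint alpha_ge0 TS x1).
  by move=> w; apply: comb_form.
Qed.
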